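(* Consider the linear advection equation $\partial_tU+\sum_{m=1}^d\partial_{x_m}(a_mU)=0$ with constant $a\in\mathbb{R}^d$, and assume: (i) for all $m\in\{1,\dots,d\}$ and all $u,v\in\mathcal{V}$, $$\Big\langle u,\frac{\partial v}{\partial\hat x_m}\Big\rangle_{\mathbf W}+\Big\langle\frac{\partial u}{\partial\hat x_m},v\Big\rangle_{\mathbf W}=\sum_{\gamma=1}^{N_f}\hat n^{(\gamma)}_m\langle u,v\rangle_{\mathbf W^{(\gamma)}};$$ (ii) $\mathbf V$ has rank $N_p$, and $\mathbf W$ and all $\mathbf W^{(\gamma)}$, $\gamma\in\{1,\dots,N_f\}$, are symmetric positive definite; (iii) $\mathbf K\mathbf D^{(m)}=\mathbf 0$ for all $m\in\{1,\dots,d\}$ and $\mathbf M+\mathbf K$ is symmetric positive definite; (iv) the mesh satisfies the conformity assumption described in the context; (v) all mappings $X^{(\kappa)}$ are affine; (vi) boundary conditions and numerical fluxes are as described in the context. Let $\mathbf L^{(\gamma)}:=(\mathbf M+\mathbf K)^{-1}(\mathbf V^{(\gamma)})^T\mathbf W^{(\gamma)}$, $\mathbf F:=(\mathbf I+\mathbf M^{-1}\mathbf K)^{-1}$ and $\mathbf F^{(\kappa)}:=(\mathbf P\mathbf J^{(\kappa)}\mathbf V)^{-1}\mathbf F(\mathbf P\mathbf J^{(\kappa)}\mathbf V)$. Let $u^{(h,\kappa)}(t)$ satisfy, for all $\kappa\in\{1,\dots,K\}$ and $t\in(0,T)$, either the flux reconstruction (FR) method $$\mathbf P\mathbf J^{(\kappa)}\mathbf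 V\frac{d u^{(h,\kappa)}}{dt}+\sum_{m=1}^d\mathbf D^{(m)}\mathbf P f^{(h,\kappa,m)}+\sum_{\gamma=1}^{N_f}\mathbf L^{(\gamma)}\Big(f^{( *,\kappa,\gamma)}-\sum_{n=1}^d\hat n^{(\gamma)}_n\mathbf V^{(\gamma)}\mathbf P f^{(h,\kappa,n)}\Big)=0,$$ or the weak-form discontinuous Galerkin (DG) method $$\mathbf M^{(\kappa)}\frac{d u^{(h,\kappa)}}{dt}-\sum_{m=1}^d(\mathbf D^{(m)})^T\mathbf V^T\mathbf W f^{(h,\kappa,m)}+\sum_{\gamma=1}^{N_f}(\mathbf V^{(\gamma)})^T\mathbf W^{(\gamma)}f^{( *,\kappa,\gamma)}=0,$$ in the latter case with $\mathbf K=\mathbf 0$ (so that $\mathbf F^{(\kappa)}=\mathbf I$). Then for all $t\in(0,T)$ $$\frac{d}{dt}\Big(\sum_{\kappa=1}^K(u^{(h,\kappa)}(t))^T\mathbf M^{(\kappa)}(\mathbf F^{(\kappa)})^{-1}u^{(h,\kappa)}(t)\Big)\le\sum_{(\kappa,\gamma)\in\mathcal{K}_{\partial\Omega^-}}|a\cdot n^{(\kappa,\gamma)}|\,(b^{(\kappa,\gamma)}(t))^T\mathbf W^{(\gamma)}\mathbf J^{(\kappa,\gamma)}b^{(\kappa,\gamma)}(t),$$ where $b^{(\kappa,\gamma)}(t):=[B(X^{(\kappa)}(\hat x^{(\gamma,1)}),t),\dots,B(X^{(\kappa)}(\hat x^{(\gamma,N_\gamma)}),t)]^T$. That is, the methods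 are energy stable in the norm $\|\cdot\|_{\mathcal{V}_h}$ defined in the context: $\|U^h(\cdot,t)\|_{\mathcal{V}_h}^2$ is the quantity differentiated on the left, and it can increase only through the inflow boundary data.
   Context: Reference element and operators. $\hat\Omega\subset\mathbb{R}^d$ is a polytope with volume $|\hat\Omega|$, flat facets $\hat\Gamma^{(\gamma)}$, $\gamma\in\{1,\dots,N_f\}$, and outward unit normals $\hat n^{(\gamma)}$. $\mathcal{V}$ is the space of real polynomial functions on $\hat\Omega$ spanned by the monomials with exponents in a finite set $\mathcal{N}\supseteq\{\alpha\in\mathbb{N}_0^d:|\alpha|\le p\}$ of $N_p$ multi-indices ($p\in\mathbb{N}_0$); $\mathcal{V}$ is assumed closed under each $\partial/\partial\hat x_m$ and contains the constants. $\{\phi^{(i)}\}_{i=1}^{N_p}$ is an arbitrary basis of $\mathcal{V}$. Volume nodes $\hat x^{(i)}\in\hat\Omega$, $i\in\{1,\dots,N\}$ ($N\ge N_p$), facet nodes $\hat x^{(\gamma,i)}\in\hat\Gamma^{(\gamma)}$, $i\in\{1,\dots,N_\gamma\}$, and matrices $\mathbf W\in\mathbb{R}^{N\times N}$, $\mathbf W^{(\gamma)}\in\mathbb{R}^{N_\gamma\times N_\gamma}$ are given; $\langle u,v\rangle_{\mathbf W}:=\sum_{i,j}u(\hat x^{(i)})W_{ij}v(\hat x^{(j)})$ and $\langle u,v\rangle_{\mathbf W^{(\gamma)}}:=\sum_{i,j}u(\hat x^{(\gamma,i)})W^{(\gamma)}_{ij}v(\hat x^{(\gamma,j)})$. Set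 $V_{ij}:=\phi^{(j)}(\hat x^{(i)})$, $V^{(\gamma)}_{ij}:=\phi^{(j)}(\hat x^{(\gamma,i)})$, $\mathbf M:=\mathbf V^T\mathbf W\mathbf V$, $\mathbf P:=\mathbf M^{-1}\mathbf V^T\mathbf W$, and define $\mathbf D^{(m)}$ by $\partial\phi^{(j)}/\partial\hat x_m=\sum_iD^{(m)}_{ij}\phi^{(i)}$. For a finite set $\mathcal{M}\subset\mathcal{N}$ and $C:\mathcal{M}\to\mathbb{R}$, $\mathbf K:=\sum_{\alpha\in\mathcal{M}}\frac{C(\alpha)}{|\hat\Omega|}(\mathbf D^{(\alpha)})^T\mathbf M\mathbf D^{(\alpha)}$ with $\mathbf D^{(\alpha)}:=(\mathbf D^{(1)})^{\alpha_1}\cdots(\mathbf D^{(d)})^{\alpha_d}$. Mesh. $\bar\Omega\subset\mathbb{R}^d$ is the union of compact elements $\Omega^{(\kappa)}$, $\kappa\in\{1,\dots,K\}$, with disjoint interiors, each the image of $\hat\Omega$ under an (affine, time-independent, bijective) map $X^{(\kappa)}$ with constant Jacobian matrix $\boldsymbol{\mathcal J}^{(\kappa)}$ and $\mathcal J^{(\kappa)}:=\det\boldsymbol{\mathcal J}^{(\kappa)}>0$; $\Gamma^{(\kappa,\gamma)}:=X^{(\kappa)}(\hat\Gamma^{(\gamma)})$ has constant outward unit normal $n^{(\kappa,\gamma)}=\mathcal J^{(\kappa)}(\boldsymbol{\mathcal J}^{(\kappa)})^{-T}\hat n^{(\gamma)}/\mathcal J^{(\kappa,\gamma)}$, with $\mathcal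 J^{(\kappa,\gamma)}:=\|\mathcal J^{(\kappa)}(\boldsymbol{\mathcal J}^{(\kappa)})^{-T}\hat n^{(\gamma)}\|_2$. $\mathbf J^{(\kappa)}:=\mathcal J^{(\kappa)}\mathbf I$, $\mathbf J^{(\kappa,\gamma)}:=\mathcal J^{(\kappa,\gamma)}\mathbf I$ and $\mathbf M^{(\kappa)}:=\mathbf V^T\mathbf W\mathbf J^{(\kappa)}\mathbf V$. Parts of the boundary may be identified periodically by translations; $\partial\Omega$ denotes only the non-periodic part. $\mathcal{K}_{\partial\Omega}$ is the set of pairs $(\kappa,\gamma)\in\{1,\dots,K\}\times\{1,\dots,N_f\}$ with $\Gamma^{(\kappa,\gamma)}\subset\partial\Omega$, and $\mathcal{K}_\Omega$ is the set of all other pairs (interior or periodic interfaces). Conformity assumption. Every $(\kappa,\gamma)\in\mathcal{K}_\Omega$ has a unique partner $(\nu,\eta)\in\mathcal{K}_\Omega$ with $\nu\ne\kappa$, partnership being symmetric, such that either $\Gamma^{(\kappa,\gamma)}=\Gamma^{(\nu,\eta)}$, or $\Gamma^{(\nu,\eta)}$ is the image of $\Gamma^{(\kappa,\gamma)}$ under a pure translation (periodic connection); in both cases $n^{(\nu,\eta)}=-n^{(\kappa,\gamma)}$. Moreover $N_\eta=N_\gamma$ and there is a permutation $\tau^{(\kappa,\gamma)}$ of $\{1,\dots,N_\gamma\}$ (with $\tau^{(\nu,\eta)}$ its inverse) such that $X^{(\kappa)}(\hat x^{(\gamma,i)})=X^{(\nu)}(\hat x^{(\eta,\tau^{(\kappa,\gamma)}(i))})$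 for all $i$, up to the translation in the periodic case. With $\mathbf T^{(\kappa,\gamma)}$ the permutation matrix whose $i$-th row is the $\tau^{(\kappa,\gamma)}(i)$-th standard basis vector, $\mathbf W^{(\eta)}\mathbf J^{(\nu,\eta)}=(\mathbf T^{(\kappa,\gamma)})^T\mathbf W^{(\gamma)}\mathbf J^{(\kappa,\gamma)}\mathbf T^{(\kappa,\gamma)}$. Boundary conditions and numerical flux. With $n$ the outward unit normal on $\partial\Omega$ (interpreted facetwise), $\partial\Omega$ is partitioned into $\partial\Omega^-:=\{x\in\partial\Omega:a\cdot n(x)\le0\}$, where $U=B$ is prescribed for a given function $B(x,t)$, and $\partial\Omega^+:=\partial\Omega\setminus\partial\Omega^-$. $\mathcal{K}_{\partial\Omega^-}:=\{(\kappa,\gamma)\in\mathcal{K}_{\partial\Omega}:\Gamma^{(\kappa,\gamma)}\subseteq\partial\Omega^-\}$ (i.e. $a\cdot n^{(\kappa,\gamma)}\le0$) and $\mathcal{K}_{\partial\Omega^+}:=\mathcal{K}_{\partial\Omega}\setminus\mathcal{K}_{\partial\Omega^-}$. The numerical flux is $F^*(U,V,n):=\frac12\sum_{m=1}^dn_m(a_mU+a_mV)-\frac\lambda2|a\cdot n|(V-U)$, where $\lambda\ge0$ takes the same value on either side of an interior (or periodic) interface and equals $1$ on facets lying on $\partial\Omega$. Semi-discrete quantities. Unknown (differentiable in $t$) vectors $u^{(h,\kappa)}(t)\in\mathbb{R}^{N_p}$ define $U^{(h,\kappa)}(\hat x,t)=\sum_iu^{(h,\kappa)}_i(t)\phi^{(i)}(\hat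 x)$ and the global function $U^h$ by $U^h|_{\Omega^{(\kappa)}}=U^{(h,\kappa)}((X^{(\kappa)})^{-1}(\cdot),t)$. The vector $f^{(h,\kappa,m)}(t)\in\mathbb{R}^N$ has entries $\sum_{n=1}^d\mathcal J^{(\kappa)}[(\boldsymbol{\mathcal J}^{(\kappa)})^{-1}]_{mn}a_nU^{(h,\kappa)}(\hat x^{(i)},t)$; the vector $f^{( *,\kappa,\gamma)}(t)\in\mathbb{R}^{N_\gamma}$ has entries $\mathcal J^{(\kappa,\gamma)}F^*(U^{(h,\kappa)}(\hat x^{(\gamma,i)},t),U^{(+,\kappa,\gamma)}(\hat x^{(\gamma,i)},t),n^{(\kappa,\gamma)})$. The external state $U^{(+,\kappa,\gamma)}(\hat x^{(\gamma,i)},t)$ is $U^{(h,\nu)}(\hat x^{(\eta,\tau^{(\kappa,\gamma)}(i))},t)$ for $(\kappa,\gamma)\in\mathcal{K}_\Omega$ with partner $(\nu,\eta)$; it is $B(X^{(\kappa)}(\hat x^{(\gamma,i)}),t)$ for $(\kappa,\gamma)\in\mathcal{K}_{\partial\Omega^-}$; and it is arbitrary for $(\kappa,\gamma)\in\mathcal{K}_{\partial\Omega^+}$ (the flux does not depend on it there). Norm. For $v\in L^2(\Omega)$ with $v|_{\Omega^{(\kappa)}}=\sum_iv^{(\kappa)}_i\phi^{(i)}\circ(X^{(\kappa)})^{-1}$ for every $\kappa$, $\|v\|_{\mathcal{V}_h}:=\sqrt{\sum_{\kappa=1}^K(v^{(\kappa)})^T\mathbf M^{(\kappa)}(\mathbf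 F^{(\kappa)})^{-1}v^{(\kappa)}}$. *)

(* Defs.v *)
From HB Require Import structures.
From mathcomp Require Import all_boot all_order all_algebra perm finmap.
From mathcomp Require Import all_classical all_reals all_analysis.

Set Implicit Arguments.
Unset Strict Implicit.
Unset Printing Implicit Defensive.

Import Order.TTheory GRing.Theory Num.Theory numFieldNormedType.Exports.

Local Open Scope classical_set_scope.
Local Open Scope ring_scope.

(* Points and vectors of R^d are column vectors.  The library norm on matrices
   is the sup norm (it induces the usual topology); Euclidean lengths are
   therefore written with [norm2]. *)
Definition dot {R : realType} {d : nat} (x y : 'cV[R]_d) : R :=
  \sum_(k < d) x k 0 * y k 0.

Definition norm2 {R : realType} {d : nat} (x : 'cV[R]_d) : R :=
  Num.sqrt (dot x x).

Definition quad {R : realType} {n : nat} (A : 'M[R]_n) (x : 'cV[R]_n) : R :=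
  (x^T *m A *m x) 0 0.

Definition spd {R : realType} {n : nat} (A : 'M[R]_n) : Prop :=
  A^T = A /\ forall x : 'cV[R]_n, x != 0 -> 0 < quad A x.

(* Partial derivative with respect to the m-th coordinate. *)
Definition pderiv {R : realType} {d : nat} (m : 'I_d) (f : 'cV[R]_d -> R) :
    'cV[R]_d -> R :=
  fun x => 'D_(delta_mx m 0 : 'cV[R]_d) f x.

(* d-dimensional Lebesgue outer measure: infimum of the total volume of the
   countable covers by boxes.  The library only has Lebesgue measure on R. *)
Definition lebesgue_outer {R : realType} {d : nat} (A : set 'cV[R]_d) : \bar R :=
  ereal_inf [set v : \bar R | exists l r : nat -> 'cV[R]_d,
    [/\ forall k i, l k i 0 <= r k i 0,
        A `<=` \bigcup_k [set x | forall i, l k i 0 <= x i 0 <= r k i 0] &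
        v = (\sum_(0 <= k <oo) (\prod_(i < d) (r k i 0 - l k i 0))%:E)%E]].

Definition volume {R : realType} {d : nat} (A : set 'cV[R]_d) : R :=
  fine (lebesgue_outer A).

Definition frontier {R : realType} {d : nat} (A : set 'cV[R]_d) : set 'cV[R]_d :=
  closure A `\` A°.

(* A (not necessarily convex) polytope together with its flat facets and their
   outward unit normals: a compact regular closed set whose boundary is covered
   by finitely many flat pieces, each of them being the closure of the set of
   its points which lie on no other piece. *)
Record is_polytope {R : realType} {d Nf : nat} (P : set 'cV[R]_d)
    (facet : 'I_Nf -> set 'cV[R]_d) (normal : 'I_Nf -> 'cV[R]_d) : Prop :=
  IsPolytope {
    polytope_nonempty : P !=set0 ;
    polytope_compact : compact P ;
    polytope_regular : closure P° = P ;
    polytope_frontier : frontier P = \bigcup_g facet g ;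
    facet_nonempty : forall g, facet g !=set0 ;
    facet_flat : forall g, exists c, facet g `<=` [set x | dot (normal g) x = c] ;
    facet_proper : forall g,
      closure (facet g `\` \bigcup_(h in [set h | h != g]) facet h) = facet g ;
    normal_unit : forall g, norm2 (normal g) = 1 ;
    normal_outward : forall g x,
      facet g x -> (forall h, h != g -> ~ facet h x) ->
      \forall s \near (0 : R)^'+,
        ~ P (x + s *: normal g) /\ P° (x - s *: normal g)
  }.

Definition multi_index (d : nat) := {ffun 'I_d -> nat}.

Definition monomial {R : realType} {d : nat} (al : multi_index d)
    (x : 'cV[R]_d) : R :=
  \prod_(k < d) x k 0 ^+ al k.

(* Reference element, polynomial space, basis, nodes, quadrature matrices,
   differentiation matrices, and the data (Mset, C) of the matrix K.
   The space dimension N_p is the number of exponents. *)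
Record ref_scheme (R : realType) (d : nat) := RefScheme {
  Nf : nat ;
  dom : set 'cV[R]_d ;
  facet : 'I_Nf -> set 'cV[R]_d ;
  nhat : 'I_Nf -> 'cV[R]_d ;
  expo : {fset multi_index d} ;
  phi : 'I_(#|` expo|) -> 'cV[R]_d -> R ;
  N : nat ;
  Ng : 'I_Nf -> nat ;
  xvol : 'I_N -> 'cV[R]_d ;
  xfac : forall g, 'I_(Ng g) -> 'cV[R]_d ;
  W : 'M[R]_N ;
  Wf : forall g, 'M[R]_(Ng g) ;
  Dm : 'I_d -> 'M[R]_(#|` expo|) ;
  Mset : {fset multi_index d} ;
  Ccoef : multi_index d -> R
}.

Definition Np {R : realType} {d : nat} (S : ref_scheme R d) : nat :=
  #|` expo S|.

Section Reference.
Context {R : realType} {d : nat} (S : ref_scheme R d).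

Definition polyV : set ('cV[R]_d -> R) :=
  [set f | exists c : multi_index d -> R,
    f = fun x => \sum_(al <- expo S) c al * monomial al x].

Definition expand (c : 'cV[R]_(Np S)) : 'cV[R]_d -> R :=
  fun x => \sum_(i < Np S) c i 0 * phi i x.

Definition ip_vol (u v : 'cV[R]_d -> R) : R :=
  \sum_(i < N S) \sum_(j < N S) u (xvol i) * W S i j * v (xvol j).

Definition ip_fac (g : 'I_(Nf S)) (u v : 'cV[R]_d -> R) : R :=
  \sum_(i < Ng g) \sum_(j < Ng g) u (xfac i) * Wf g i j * v (xfac j).

Record ref_scheme_ok (p : nat) : Prop := RefSchemeOk {
  dom_polytope : is_polytope (dom S) (@facet R d S) (@nhat R d S) ;
  expo_total_degree : forall al : multi_index d,
    (\sum_(k < d) al k <= p)%N -> al \in expo S ;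
  polyV_deriv : forall m f, polyV f -> polyV (pderiv m f) ;
  phi_in : forall i, polyV (@phi R d S i) ;
  phi_basis : forall f, polyV f -> exists! c : 'cV[R]_(Np S), f = expand c ;
  xvol_in : forall i, dom S (@xvol R d S i) ;
  xfac_in : forall g i, facet g (@xfac R d S g i) ;
  N_ge_Np : (Np S <= N S)%N ;
  Dm_spec : forall m (j : 'I_(Np S)),
    pderiv m (phi j) = fun x => \sum_(i < Np S) Dm S m i j * phi i x ;
  Mset_sub : {subset Mset S <= expo S}
}.

Definition Vmx : 'M[R]_(N S, Np S) := \matrix_(i, j) phi j (xvol i).

Definition Vfmx (g : 'I_(Nf S)) : 'M[R]_(Ng g, Np S) :=
  \matrix_(i, j) phi j (xfac i).

Definition Mmx : 'M[R]_(Np S) := Vmx^T *m W S *m Vmx.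

Definition Pmx : 'M[R]_(Np S, N S) := invmx Mmx *m Vmx^T *m W S.

Definition Dalpha (al : multi_index d) : 'M[R]_(Np S) :=
  \prod_(m < d) Dm S m ^+ al m.

Definition Kmx : 'M[R]_(Np S) :=
  \sum_(al <- Mset S)
    (Ccoef S al / volume (dom S)) *: ((Dalpha al)^T *m Mmx *m Dalpha al).

Definition Lmx (g : 'I_(Nf S)) : 'M[R]_(Np S, Ng g) :=
  invmx (Mmx + Kmx) *m (Vfmx g)^T *m Wf g.

Definition Fmx : 'M[R]_(Np S) := invmx (1%:M + invmx Mmx *m Kmx).

Definition SBP_property : Prop :=
  forall (m : 'I_d) (u v : 'cV[R]_d -> R), polyV u -> polyV v ->
    ip_vol u (pderiv m v) + ip_vol (pderiv m u) v =
    \sum_(g < Nf S) nhat g m 0 * ip_fac g u v.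

End Reference.

(* [X k] maps the reference element onto the k-th element, [Jac k] is its
   Jacobian matrix, and [pbnd] is the part of the boundary of the union of the
   elements that is identified periodically.  The remaining fields are only
   constrained on interior and periodic interfaces (see [conformity]): [partner]
   is the facet on the other side, [transl] the translation mapping the facet
   onto its partner (0 unless the connection is periodic), and [tau] the
   matching of the facet nodes. *)
Record mesh (R : realType) (d : nat) (S : ref_scheme R d) := Mesh {
  nK : nat ;
  X : 'I_nK -> 'cV[R]_d -> 'cV[R]_d ;
  Jac : 'I_nK -> 'M[R]_d ;
  pbnd : set 'cV[R]_d ;
  partner : 'I_nK -> 'I_(Nf S) -> 'I_nK * 'I_(Nf S) ;
  transl : 'I_nK -> 'I_(Nf S) -> 'cV[R]_d ;
  tau : 'I_nK -> forall g : 'I_(Nf S), {perm 'I_(Ng g)}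
}.

Section Mesh.
Context {R : realType} {d : nat} {S : ref_scheme R d} (G : mesh S).
Implicit Types (k : 'I_(nK G)) (g : 'I_(Nf S)).

Definition elem k : set 'cV[R]_d := X k @` dom S.

Definition efacet k g : set 'cV[R]_d := X k @` facet g.

Definition Omega_bar : set 'cV[R]_d := \bigcup_k elem k.

(* The non-periodic part of the boundary.  It is closed, so that a facet of it
   may share lower-dimensional faces with periodic facets. *)
Definition bOmega : set 'cV[R]_d := closure (frontier Omega_bar `\` pbnd G).

Definition Jdet k : R := \det (Jac k).

Definition scaled_normal k g : 'cV[R]_d :=
  Jdet k *: ((invmx (Jac k))^T *m nhat g).

Definition Jfac k g : R := norm2 (scaled_normal k g).

Definition enormal k g : 'cV[R]_d := (Jfac k g)^-1 *: scaled_normal k g.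

Definition boundary_pair k g : Prop := efacet k g `<=` bOmega.

Definition interface_pair k g : Prop := ~ boundary_pair k g.

Record mesh_ok : Prop := MeshOk {
  Jdet_gt0 : forall k, 0 < Jdet k ;
  elem_disjoint : forall k l, k != l -> (elem k)° `&` (elem l)° = set0 ;
  pbnd_sub : pbnd G `<=` frontier Omega_bar
}.

Definition affine_mappings : Prop :=
  forall k, exists b : 'cV[R]_d, forall x, X k x = Jac k *m x + b.

Definition conformity : Prop :=
  forall k g, interface_pair k g ->
    let l := (partner k g).1 in
    let h := (partner k g).2 in
    let c := transl k g in
    [/\ interface_pair l h, l != k, partner l h = (k, g),
        (c = 0 /\ efacet l h = efacet k g) \/
        [/\ efacet k g `<=` pbnd G, efacet l h `<=` pbnd G &
            efacet l h = [set x + c | x in efacet k g]] &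
        enormal l h = - enormal k g] /\
    exists e : Ng h = Ng g,
      [/\ cast_perm e (tau l h) = (tau k g)^-1%g,
          forall i : 'I_(Ng g),
            X k (xfac i) + c = X l (xfac (cast_ord (esym e) (tau k g i))) &
          castmx (e, e) (Wf h *m (Jfac l h)%:M) =
          (perm_mx (tau k g))^T *m (Wf g *m (Jfac k g)%:M) *m
            perm_mx (tau k g)].

Definition Jk k : 'M[R]_(N S) := (Jdet k)%:M.

Definition Mk k : 'M[R]_(Np S) := (Vmx S)^T *m W S *m Jk k *m Vmx S.

Definition Fk k : 'M[R]_(Np S) :=
  invmx (Pmx S *m Jk k *m Vmx S) *m Fmx S *m (Pmx S *m Jk k *m Vmx S).

Definition energy (v : 'I_(nK G) -> 'cV[R]_(Np S)) : R :=
  \sum_(k < nK G) quad (Mk k *m invmx (Fk k)) (v k).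

(* [v] restricts on each element to the pushforward of the polynomial with
   coefficients [c k].  Being discontinuous across the (null) interfaces, [v] is
   only constrained in the interiors of the elements. *)
Definition broken_poly (v : 'cV[R]_d -> R)
    (c : 'I_(nK G) -> 'cV[R]_(Np S)) : Prop :=
  forall k x, dom S x -> (elem k)° (X k x) -> v (X k x) = expand (c k) x.

Definition Vh_norm (v : 'cV[R]_d -> R) : R :=
  Num.sqrt (energy (xget (fun=> 0) [set c | broken_poly v c])).

End Mesh.

Section Advection.
Context {R : realType} {d : nat} {S : ref_scheme R d} (G : mesh S).
Context (a : 'cV[R]_d).
Implicit Types (k : 'I_(nK G)) (g : 'I_(Nf S)).

Definition inflow_pair k g : Prop :=
  boundary_pair k g /\ dot a (enormal k g) <= 0.

Definition num_flux (lam : R) (U V : R) (n : 'cV[R]_d) : R :=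
  2^-1 * (\sum_(m < d) n m 0 * (a m 0 * U + a m 0 * V))
  - lam / 2 * `|dot a n| * (V - U).

Definition flux_param_ok (lam : 'I_(nK G) -> 'I_(Nf S) -> R) : Prop :=
  [/\ forall k g, 0 <= lam k g,
      forall k g, interface_pair k g ->
        lam (partner k g).1 (partner k g).2 = lam k g &
      forall k g, boundary_pair k g -> lam k g = 1].

Definition bdata (B : 'cV[R]_d -> R -> R) k g (t : R) : 'cV[R]_(Ng g) :=
  \col_i B (X k (xfac i)) t.

(* Nothing is required of the external state on outflow facets. *)
Definition external_state (B : 'cV[R]_d -> R -> R) (T : R)
    (u : 'I_(nK G) -> R -> 'cV[R]_(Np S))
    (Uext : 'I_(nK G) -> forall g : 'I_(Nf S), 'I_(Ng g) -> R -> R) : Prop :=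
  forall k g (i : 'I_(Ng g)) (t : R), 0 < t < T ->
    (interface_pair k g ->
       forall e : Ng (partner k g).2 = Ng g,
         Uext k g i t =
         expand (u (partner k g).1 t)
           (xfac (cast_ord (esym e) (tau k g i)))) /\
    (inflow_pair k g -> Uext k g i t = B (X k (xfac i)) t).

Definition vol_flux k (m : 'I_d) (c : 'cV[R]_(Np S)) : 'cV[R]_(N S) :=
  \col_i \sum_(n < d)
    Jdet k * invmx (Jac k) m n * a n 0 * expand c (xvol i).

Definition fac_flux (lam : 'I_(nK G) -> 'I_(Nf S) -> R) k g
    (c : 'cV[R]_(Np S)) (ext : 'I_(Ng g) -> R) : 'cV[R]_(Ng g) :=
  \col_i (Jfac k g *
          num_flux (lam k g) (expand c (xfac i)) (ext i) (enormal k g)).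

Definition FR_method (lam : 'I_(nK G) -> 'I_(Nf S) -> R) (T : R)
    (u : 'I_(nK G) -> R -> 'cV[R]_(Np S))
    (Uext : 'I_(nK G) -> forall g : 'I_(Nf S), 'I_(Ng g) -> R -> R) : Prop :=
  forall k (t : R), 0 < t < T ->
    Pmx S *m Jk k *m Vmx S *m (u k)^`()%classic t
    + \sum_(m < d) Dm S m *m Pmx S *m vol_flux k m (u k t)
    + \sum_(g < Nf S) Lmx g *m
        (fac_flux lam k (u k t) (fun i => Uext k g i t)
         - \sum_(n < d)
             nhat g n 0 *: (Vfmx g *m Pmx S *m vol_flux k n (u k t)))
    = 0.

Definition DG_method (lam : 'I_(nK G) -> 'I_(Nf S) -> R) (T : R)
    (u : 'I_(nK G) -> R -> 'cV[R]_(Np S))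
    (Uext : 'I_(nK G) -> forall g : 'I_(Nf S), 'I_(Ng g) -> R -> R) : Prop :=
  forall k (t : R), 0 < t < T ->
    Mk k *m (u k)^`()%classic t
    - \sum_(m < d) (Dm S m)^T *m (Vmx S)^T *m W S *m vol_flux k m (u k t)
    + \sum_(g < Nf S) (Vfmx g)^T *m Wf g *m
        fac_flux lam k (u k t) (fun i => Uext k g i t)
    = 0.

End Advection.

(* Main.v *)
Require Import Defs.
From HB Require Import structures.
From mathcomp Require Import all_boot all_order all_algebra perm finmap.
From mathcomp Require Import all_classical all_reals all_analysis.
From mathcomp Require Import ring lra.

Set Implicit Arguments.
Unset Strict Implicit.
Unset Printing Implicit Defensive.

Import Order.TTheory GRing.Theory Num.Theory numFieldNormedType.Exports.

Local Open Scope classical_set_scope.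
Local Open Scope ring_scope.

(** The proof is an energy estimate.  On an affine element the modified mass
    matrix [Mk k *m invmx (Fk k)] is just [Jdet k *: (M + K)] (lemma
    [Mk_invFk]), so the time derivative of the energy is the sum over the
    elements of [2 J u^T (M + K) u'].

    Multiplying the flux reconstruction method by [M + K] turns [L] into
    [V_g^T W_g], and [K D_m = 0] removes [K] from the volume term; what is left
    is the strong form of the discontinuous Galerkin method.  Testing with [u]
    and using summation by parts, [2 u^T M D_m u] becomes a sum over the facets
    ([SBP_quad]), and both methods give the same rate: a sum over the facets of
    [lam |s| (w.v - w.w) - s (w.v)], where [s = a.n], [w] collects the interior
    nodal values, [v] the exterior ones, and the dot is the inner product of
    the facet quadrature weighted by the facet Jacobian ([FR_rate],
    [DG_rate]).  It remains to bound the facets.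

    - On an interface, the two sides see the same inner product, opposite [s]
      and exchanged roles of [w] and [v].  The terms in [s] cancel, and the sum
      is [- lam |s|] times the squared norm of the jump
      ([interface_pair_dissipates]).
    - On an outflow facet the rate is [- s (w.w) <= 0].
    - On an inflow facet it is [|s| (2 w.v - w.w) <= |s| (v.v)], and [v] is the
      boundary data.

    The identity between the norm and the energy requires the coefficients of a
    broken polynomial to be determined by its values inside the elements.  The
    nodes lie in the closure of the interior of the reference element, so
    continuity gives the nodal values, and [V] has full column rank
    ([expand_eq_on_interior]). *)

(** * Bilinear forms given by matrices *)

(** [A] may be rectangular so that an interpolation matrix can be moved from an
    argument into the form: [bform_mulr], [bform_mull]. *)
Definition bform {R : realType} {m n : nat} (A : 'M[R]_(m, n))
    (x : 'cV[R]_m) (y : 'cV[R]_n) : R :=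
  (x^T *m A *m y) 0 0.

Section BilinearForms.
Context {R : realType}.

Lemma bform_tr m n (A : 'M[R]_(m, n)) x y : bform A^T y x = bform A x y.
Proof.
have -> : bform A x y = ((x^T *m A *m y)^T) 0 0 by rewrite mxE.
by rewrite /bform !trmx_mul trmxK mulmxA.
Qed.

Lemma bformC n (A : 'M[R]_n) x y : A^T = A -> bform A x y = bform A y x.
Proof. by move=> As; rewrite -bform_tr As. Qed.

Lemma bformDr m n (A : 'M[R]_(m, n)) x y z :
  bform A x (y + z) = bform A x y + bform A x z.
Proof. by rewrite /bform mulmxDr mxE. Qed.

Lemma bformZr m n (A : 'M[R]_(m, n)) c x y :
  bform A x (c *: y) = c * bform A x y.
Proof. by rewrite /bform -scalemxAr mxE. Qed.

Lemma bformBr m n (A : 'M[R]_(m, n)) x y z :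
  bform A x (y - z) = bform A x y - bform A x z.
Proof. by rewrite bformDr -scaleN1r bformZr mulN1r. Qed.

Lemma bform_sumr m n (A : 'M[R]_(m, n)) x (I : finType) (F : I -> 'cV[R]_n) :
  bform A x (\sum_i F i) = \sum_i bform A x (F i).
Proof. by rewrite /bform mulmx_sumr summxE. Qed.

Lemma bformDA m n (A B : 'M[R]_(m, n)) x y :
  bform (A + B) x y = bform A x y + bform B x y.
Proof. by rewrite /bform mulmxDr mulmxDl mxE. Qed.

Lemma bformZA m n (A : 'M[R]_(m, n)) c x y :
  bform (c *: A) x y = c * bform A x y.
Proof. by rewrite /bform -scalemxAr -scalemxAl mxE. Qed.

Lemma bform_sumA m n (I : finType) (A : I -> 'M[R]_(m, n)) x y :
  bform (\sum_i A i) x y = \sum_i bform (A i) x y.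
Proof. by rewrite /bform mulmx_sumr mulmx_suml summxE. Qed.

Lemma bform_mulr m n p (A : 'M[R]_(m, n)) (B : 'M[R]_(n, p)) x y :
  bform A x (B *m y) = bform (A *m B) x y.
Proof. by rewrite /bform !mulmxA. Qed.

Lemma bform_mull m n p (A : 'M[R]_(m, n)) (B : 'M[R]_(m, p)) x y :
  bform A (B *m x) y = bform (B^T *m A) x y.
Proof. by rewrite /bform trmx_mul !mulmxA. Qed.

Lemma quadE n (A : 'M[R]_n) x : quad A x = bform A x x.
Proof. by []. Qed.

Lemma spd_quad_ge0 n (A : 'M[R]_n) x : spd A -> 0 <= quad A x.
Proof.
move=> [_ Ap]; have [->|/Ap/ltW//] := eqVneq x 0.
by rewrite /quad mulmx0 mxE.
Qed.

(** This is the nonnegativity of the form at [x - y]. *)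
Lemma spd_polarization n (A : 'M[R]_n) x y : spd A ->
  2 * bform A x y <= quad A x + quad A y.
Proof.
move=> Ap; have := spd_quad_ge0 (x - y) Ap; have [As _] := Ap.
rewrite quadE bformBr !(bformC (x - y)) // !bformBr !quadE (bformC y x) //.
lra.
Qed.

Lemma spd_unitmx n (A : 'M[R]_n) : spd A -> A \in unitmx.
Proof.
move=> [As Ap]; rewrite -row_free_unit -kermx_eq0.
apply: contraT => /rowV0Pn[v /sub_kermxP vA0 v0].
have /Ap : v^T != 0 by rewrite trmx_eq0.
by rewrite /quad trmxK vA0 mul0mx mxE ltxx.
Qed.

Lemma spd_congr m n (A : 'M[R]_m) (B : 'M[R]_(m, n)) :
  spd A -> \rank B = n -> spd (B^T *m A *m B).
Proof.
move=> [As Ap] rB; split; first by rewrite !trmx_mul trmxK As mulmxA.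
move=> x x0; rewrite quadE -bform_mulr -bform_mull; apply: Ap.
rewrite -trmx_eq0 trmx_mul mulmx_free_eq0 ?trmx_eq0 //.
by rewrite /row_free mxrank_tr rB.
Qed.

End BilinearForms.

(** * The reference element *)

Section Reference.
Context {R : realType} {d : nat} (S : ref_scheme R d).

Lemma Mmx_spd : spd (W S) -> \rank (Vmx S) = Np S -> spd (Mmx S).
Proof. exact: spd_congr. Qed.

Lemma Pmx_Vmx : Mmx S \in unitmx -> Pmx S *m Vmx S = 1%:M.
Proof. by move=> Mu; rewrite /Pmx -!mulmxA [_^T *m _]mulmxA mulVmx. Qed.

(** Each entry is the summation-by-parts identity for two basis functions. *)
Lemma SBP_matrix p (S_ok : ref_scheme_ok S p) (sbp : SBP_property S) m :
  Mmx S *m Dm S m + (Dm S m)^T *m Mmx S =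
  \sum_g nhat g m 0 *: ((Vfmx g)^T *m Wf g *m Vfmx g).
Proof.
have ipE (q : nat) (A : 'M[R]_q) (r1 r2 : nat) (B : 'M[R]_(q, r1))
    (C : 'M[R]_(q, r2)) i j : (B^T *m A *m C) i j =
    \sum_(k < q) \sum_(l < q) B k i * A k l * C l j.
  rewrite mxE exchange_big /=; apply: eq_bigr => l _; rewrite mxE big_distrl /=.
  by apply: eq_bigr => k _; rewrite mxE.
apply/matrixP => i j.
have := sbp m _ _ (phi_in S_ok i) (phi_in S_ok j).
rewrite !(Dm_spec S_ok) => E.
rewrite mxE summxE.
transitivity (ip_vol S (phi i)
    (fun x => \sum_(i0 < Np S) Dm S m i0 j * phi i0 x) +
    ip_vol S (fun x => \sum_(i0 < Np S) Dm S m i0 i * phi i0 x) (phi j)).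
  rewrite /Mmx !mulmxA -[_ *m Dm S m]mulmxA -[(Dm S m)^T *m (Vmx S)^T]trmx_mul.
  rewrite !ipE; congr (_ + _); apply: eq_bigr => k _; apply: eq_bigr => l _.
    rewrite mxE; congr (_ * _); rewrite mxE.
    by apply: eq_bigr => q _; rewrite mxE mulrC.
  rewrite !mxE; congr (_ * _ * _).
  by apply: eq_bigr => q _; rewrite mxE mulrC.
rewrite E; apply: eq_bigr => g _; rewrite mxE ipE; congr (_ * _).
by apply: eq_bigr => k _; apply: eq_bigr => l _; rewrite !mxE.
Qed.

(** Discrete counterpart of the divergence theorem for the square of a
    polynomial: both terms on the left of [SBP_matrix] have the same quadratic
    form. *)
Lemma SBP_quad p (S_ok : ref_scheme_ok S p) (sbp : SBP_property S)
    (Ms : (Mmx S)^T = Mmx S) m c :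
  2 * bform (Mmx S) c (Dm S m *m c) =
  \sum_g nhat g m 0 * quad (Wf g) (Vfmx g *m c).
Proof.
rewrite mulr_natl mulr2n bform_mulr -[in X in _ + X]bform_tr trmx_mul Ms.
rewrite -bformDA (SBP_matrix S_ok sbp) bform_sumA; apply: eq_bigr => g _.
by rewrite bformZA quadE bform_mulr bform_mull mulmxA.
Qed.

Lemma expand_xvol (c : 'cV[R]_(Np S)) i :
  Defs.expand c (xvol i) = (Vmx S *m c) i 0.
Proof. by rewrite mxE; apply: eq_bigr => j _; rewrite mxE mulrC. Qed.

Lemma expand_xfac (g : 'I_(Nf S)) c i :
  Defs.expand c (xfac i) = (Vfmx g *m c) i 0.
Proof. by rewrite mxE; apply: eq_bigr => j _; rewrite mxE mulrC. Qed.

End Reference.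

Lemma dotE (R : realType) d (x y : 'cV[R]_d) : dot x y = (x^T *m y) 0 0.
Proof. by rewrite mxE; apply: eq_bigr => k _; rewrite mxE. Qed.

Lemma norm2_eq0 (R : realType) d (x : 'cV[R]_d) : norm2 x = 0 -> x = 0.
Proof.
move=> /eqP; rewrite sqrtr_eq0 => x0.
apply/matrixP => i j; rewrite ord1 mxE; apply/eqP; rewrite -sqrf_eq0.
rewrite eq_le sqr_ge0 andbT; apply: le_trans x0.
rewrite /dot (bigD1 i) //= expr2 lerDl; apply: sumr_ge0 => k _.
by rewrite -expr2 sqr_ge0.
Qed.

(** * Elements and facets of the mesh *)

Section Mesh.
Context {R : realType} {d : nat} {S : ref_scheme R d} (G : mesh S).
Implicit Types (k : 'I_(nK G)) (g : 'I_(Nf S)).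

Lemma Pmx_Jk_Vmx k : Mmx S \in unitmx -> Pmx S *m Jk k *m Vmx S = (Jdet k)%:M.
Proof.
by move=> Mu; rewrite mul_mx_scalar -scalemxAl Pmx_Vmx // scale_scalar_mx mulr1.
Qed.

Lemma Mk_scale k : Mk k = Jdet k *: Mmx S.
Proof. by rewrite /Mk mul_mx_scalar -scalemxAl. Qed.

(** The Jacobian is constant, so conjugating [F] by [P J V] does nothing, and
    [M (I + M^-1 K) = M + K]. *)
Lemma Mk_invFk k : Mmx S \in unitmx -> Jdet k != 0 ->
  Mk k *m invmx (Fk k) = Jdet k *: (Mmx S + Kmx S).
Proof.
move=> Mu J0; rewrite Mk_scale /Fk Pmx_Jk_Vmx // invmx_scalar.
rewrite mul_scalar_mx mul_mx_scalar scalerA mulfV // scale1r /Fmx invmxK.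
by rewrite -scalemxAl mulmxDr mulmx1 mulKVmx.
Qed.

Lemma energyE v : Mmx S \in unitmx -> (forall k, 0 < Jdet k) ->
  energy v = \sum_(k < nK G) Jdet k * quad (Mmx S + Kmx S) (v k).
Proof.
move=> Mu J0; apply: eq_bigr => k _.
by rewrite Mk_invFk ?gt_eqF // quadE bformZA.
Qed.

(** Where the facet Jacobian vanishes, so does the scaled normal. *)
Lemma Jfac_enormal k g : Jfac k g *: enormal k g = scaled_normal k g.
Proof.
have [J0|J0] := eqVneq (Jfac k g) 0; last by rewrite scalerA mulfV // scale1r.
by rewrite J0 scale0r (norm2_eq0 J0).
Qed.

Definition facet_mass k g : 'M[R]_(Ng g) := Wf g *m (Jfac k g)%:M.

Lemma bform_facet_mass k g x y :
  bform (facet_mass k g) x y = Jfac k g * bform (Wf g) x y.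
Proof. by rewrite /facet_mass mul_mx_scalar bformZA. Qed.

Lemma Jfac_ge0 k g : 0 <= Jfac k g.
Proof. exact: sqrtr_ge0. Qed.

Context (Wf_spd : forall g : 'I_(Nf S), spd (Wf g)).

Lemma facet_mass_ge0 k g x : 0 <= quad (facet_mass k g) x.
Proof.
by rewrite quadE bform_facet_mass mulr_ge0 ?Jfac_ge0 // spd_quad_ge0.
Qed.

Lemma facet_mass_polarization k g x y :
  2 * bform (facet_mass k g) x y <=
  quad (facet_mass k g) x + quad (facet_mass k g) y.
Proof.
rewrite !quadE !bform_facet_mass -mulrDr mulrCA ler_wpM2l ?Jfac_ge0 //.
exact: spd_polarization.
Qed.

End Mesh.

(** * Rate of change of the energy of one element *)

Section Element.
Context {R : realType} {d : nat} {S : ref_scheme R d} (G : mesh S).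
Context (a : 'cV[R]_d).
Implicit Types (k : 'I_(nK G)) (g : 'I_(Nf S)).

(** The contravariant components of [a], that is, the advection velocity pulled
    back to the reference element. *)
Definition ref_velocity k : 'cV[R]_d := Jdet k *: (invmx (Jac k) *m a).

Lemma dot_ref_velocity k g :
  dot (ref_velocity k) (nhat g) = Jfac k g * dot a (enormal k g).
Proof.
rewrite (dotE a).
have -> : Jfac k g * (a^T *m enormal k g) 0 0 = (a^T *m scaled_normal k g) 0 0.
  by rewrite -[in RHS]Jfac_enormal -[in RHS]scalemxAr [RHS]mxE.
rewrite dotE /ref_velocity /scaled_normal linearZ /= !trmx_mul.
by rewrite -scalemxAl -scalemxAr !mulmxA.
Qed.

Lemma vol_fluxE k m c :
  vol_flux a k m c = ref_velocity k m 0 *: (Vmx S *m c).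
Proof.
apply/matrixP => i j; rewrite ord1 [LHS]mxE [RHS]mxE -expand_xvol -mulr_suml.
congr (_ * _); rewrite 2!mxE mulr_sumr; apply: eq_bigr => n _; ring.
Qed.

Lemma fac_fluxE (lam : 'I_(nK G) -> 'I_(Nf S) -> R) k g c ext :
  let s := dot a (enormal k g) in
  fac_flux a lam k (g := g) c ext =
    (Jfac k g * (s + lam k g * `|s|) / 2) *: (Vfmx g *m c) +
    (Jfac k g * (s - lam k g * `|s|) / 2) *: (\col_i ext i).
Proof.
move=> s; apply/matrixP => i j; rewrite ord1 [LHS]mxE [RHS]mxE.
rewrite [X in _ = X + _]mxE [X in _ = _ + X]mxE -expand_xfac mxE /num_flux -/s.
set U := Defs.expand c _; set V := ext i.
have -> : \sum_m (enormal k g) m 0 * (a m 0 * U + a m 0 * V) = s * (U + V).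
  by rewrite /s /dot mulr_suml; apply: eq_bigr => m _; ring.
by field.
Qed.

(** Contribution of a facet to the time derivative of the energy, for interior
    nodal values [w] and exterior ones [v]. *)
Definition facet_rate (lam : 'I_(nK G) -> 'I_(Nf S) -> R) k g
    (w v : 'cV[R]_(Ng g)) : R :=
  let s := dot a (enormal k g) in
  lam k g * `|s| * (bform (facet_mass k g) w v - quad (facet_mass k g) w)
  - s * bform (facet_mass k g) w v.

Lemma advection_volume p (S_ok : ref_scheme_ok S p) (sbp : SBP_property S)
    (Ms : (Mmx S)^T = Mmx S) k c :
  2 * \sum_m ref_velocity k m 0 * bform (Mmx S) c (Dm S m *m c) =
  \sum_g Jfac k g * dot a (enormal k g) * quad (Wf g) (Vfmx g *m c).
Proof.
rewrite mulr_sumr.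
under eq_bigr => m _ do rewrite mulrCA (SBP_quad S_ok sbp Ms) mulr_sumr.
rewrite exchange_big; apply: eq_bigr => g _ /=.
rewrite -dot_ref_velocity /dot mulr_suml.
by apply: eq_bigr => m _; rewrite mulrA.
Qed.

Context (p : nat) (S_ok : ref_scheme_ok S p) (sbp : SBP_property S).
Context (M_spd : spd (Mmx S)) (MK_spd : spd (Mmx S + Kmx S)).
Context (KD : forall m, Kmx S *m Dm S m = 0).
Context (lam : 'I_(nK G) -> 'I_(Nf S) -> R).

(** Testing either method with its own solution leads to the hypothesis below.
    Twice its volume term is the facet term [s (w.w)], which the part of the
    numerical flux proportional to the interior value [w] cancels up to
    dissipation. *)
Lemma weak_form_rate k c du (ext : forall g, 'I_(Ng g) -> R) :
  bform (Mmx S + Kmx S) c (Jdet k *: du) =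
    \sum_m ref_velocity k m 0 * bform (Mmx S) c (Dm S m *m c)
    - \sum_g bform (Wf g) (Vfmx g *m c) (fac_flux a lam k c (ext g)) ->
  2 * (Jdet k * bform (Mmx S + Kmx S) c du) =
  \sum_g facet_rate lam k (Vfmx g *m c) (\col_i ext g i).
Proof.
rewrite -bformZr => ->.
rewrite mulrBr (advection_volume S_ok) //; last by case: M_spd.
rewrite mulr_sumr -sumrB; apply: eq_bigr => g _.
rewrite fac_fluxE bformDr !bformZr /facet_rate !quadE !bform_facet_mass.
by field.
Qed.

(** Multiplication by [M + K] cancels the inverse in [L], while [K D_m = 0]
    reduces the volume term to that of the mass matrix alone.  The result is the
    strong form; [advection_volume] accounts for the interior flux it
    subtracts. *)
Lemma FR_rate k c du (ext : forall g, 'I_(Ng g) -> R) :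
  Pmx S *m Jk k *m Vmx S *m du
    + \sum_(m < d) Dm S m *m Pmx S *m vol_flux a k m c
    + \sum_(g < Nf S) Lmx g *m
        (fac_flux a lam k c (ext g)
         - \sum_(n < d) nhat g n 0 *: (Vfmx g *m Pmx S *m vol_flux a k n c))
    = 0 ->
  2 * (Jdet k * bform (Mmx S + Kmx S) c du) =
  \sum_g facet_rate lam k (Vfmx g *m c) (\col_i ext g i).
Proof.
have Mu := spd_unitmx M_spd.
rewrite Pmx_Jk_Vmx // mul_scalar_mx => E; apply: weak_form_rate.
have {}E : Jdet k *: du =
    - (\sum_(m < d) ref_velocity k m 0 *: (Dm S m *m c))
    - \sum_(g < Nf S) Lmx g *m (fac_flux a lam k c (ext g) -
        (Jfac k g * dot a (enormal k g)) *: (Vfmx g *m c)).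
  apply/eqP; rewrite -opprD -addr_eq0 addrA; apply/eqP; rewrite -[RHS]E.
  congr (_ + _ + _).
    apply: eq_bigr => m _; rewrite vol_fluxE -scalemxAr.
    by rewrite -mulmxA (mulmxA (Pmx S)) Pmx_Vmx // mul1mx.
  apply: eq_bigr => g _; congr (_ *m (_ - _)).
  rewrite -dot_ref_velocity /dot scaler_suml; apply: eq_bigr => m _.
  rewrite vol_fluxE -scalemxAr scalerA -mulmxA (mulmxA (Pmx S)) Pmx_Vmx //.
  by rewrite mul1mx mulrC.
rewrite E bformBr -scaleN1r bformZr !bform_sumr mulN1r.
have -> : \sum_(m < d) bform (Mmx S + Kmx S) c
     (ref_velocity k m 0 *: (Dm S m *m c)) =
     \sum_m ref_velocity k m 0 * bform (Mmx S) c (Dm S m *m c).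
  by apply: eq_bigr => m _; rewrite bformZr !bform_mulr mulmxDl KD addr0.
have -> : \sum_g bform (Mmx S + Kmx S) c
    (Lmx g *m (fac_flux a lam k c (ext g) -
       (Jfac k g * dot a (enormal k g)) *: (Vfmx g *m c))) =
  \sum_g bform (Wf g) (Vfmx g *m c) (fac_flux a lam k c (ext g)) -
  \sum_g Jfac k g * dot a (enormal k g) * quad (Wf g) (Vfmx g *m c).
  rewrite -sumrB; apply: eq_bigr => g _.
  rewrite /Lmx bform_mulr -!mulmxA mulKVmx ?spd_unitmx // -bform_mull.
  by rewrite bformBr bformZr.
rewrite -(advection_volume S_ok sbp); last by case: M_spd.
ring.
Qed.

Lemma DG_rate k c du (ext : forall g, 'I_(Ng g) -> R) : Kmx S = 0 ->
  Mk k *m du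
    - \sum_(m < d) (Dm S m)^T *m (Vmx S)^T *m W S *m vol_flux a k m c
    + \sum_(g < Nf S) (Vfmx g)^T *m Wf g *m fac_flux a lam k c (ext g)
    = 0 ->
  2 * (Jdet k * bform (Mmx S + Kmx S) c du) =
  \sum_g facet_rate lam k (Vfmx g *m c) (\col_i ext g i).
Proof.
move=> K0 E; apply: weak_form_rate; rewrite K0 addr0.
have -> : bform (Mmx S) c (Jdet k *: du) = bform 1%:M c (Mk k *m du).
  by rewrite Mk_scale bform_mulr mul1mx bformZr bformZA.
have {E} -> : Mk k *m du =
  \sum_(m < d) (Dm S m)^T *m (Vmx S)^T *m W S *m vol_flux a k m c
   - \sum_(g < Nf S) (Vfmx g)^T *m Wf g *m fac_flux a lam k c (ext g).
  by apply/eqP; rewrite -subr_eq0 -[X in _ == X]E opprB addrA addrAC.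
rewrite bformBr !bform_sumr; congr (_ - _); apply: eq_bigr => i _.
  rewrite vol_fluxE -scalemxAr bformZr; congr (_ * _).
  have [Ms _] := M_spd.
  rewrite !bform_mulr mul1mx -bform_tr -[in RHS]Ms; congr (bform _ _ _).
  by rewrite /Mmx !trmx_mul !trmxK !mulmxA.
by rewrite bform_mulr mul1mx bform_mull.
Qed.

End Element.

(** * Sum of the facet contributions over the mesh *)

(** The two sides of an interface carry the same quadrature up to a relabelling
    of the nodes.  Exterior values are interior values of the other side read
    through the relabelling, so the two forms exchange their arguments. *)
Lemma bform_relabel (R : realType) m n (e : m = n) (A : 'M[R]_m) (B : 'M[R]_n)
    (sA : 'S_m) (sB : 'S_n) (x x' : 'cV[R]_m) (y y' : 'cV[R]_n) :
  cast_perm e sA = (sB^-1)%g ->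
  castmx (e, e) A = (perm_mx sB)^T *m B *m perm_mx sB ->
  (forall i, y' i 0 = x (cast_ord (esym e) (sB i)) 0) ->
  (forall i, x' i 0 = y (cast_ord e (sA i)) 0) ->
  bform A x x' = bform B y' y /\ quad A x = quad B y'.
Proof.
case: n / e B sB y y' => B sB y y'.
rewrite cast_perm_id castmx_id => -> -> y'E x'E.
have -> : y' = perm_mx sB *m x.
  rewrite -row_permE; apply/matrixP => i j.
  by rewrite ord1 mxE y'E cast_ord_id.
have -> : x' = (perm_mx sB)^T *m y.
  rewrite tr_perm_mx -row_permE; apply/matrixP => i j.
  by rewrite ord1 mxE x'E cast_ord_id.
split; last by rewrite !quadE bform_mulr bform_mull mulmxA.
rewrite bform_mulr bform_mull -[_ *m _^T]mulmxA tr_perm_mx -perm_mxM mulgV.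
by rewrite perm_mx1 mulmx1.
Qed.

Section GlobalBalance.
Context {R : realType} {d : nat} {S : ref_scheme R d} (G : mesh S).
Context (a : 'cV[R]_d) (lam : 'I_(nK G) -> 'I_(Nf S) -> R).
Context (Wf_spd : forall g : 'I_(Nf S), spd (Wf g)).
Implicit Types (k : 'I_(nK G)) (g : 'I_(Nf S)).

Lemma facet_rate_outflow k g w v : lam k g = 1 -> 0 <= dot a (enormal k g) ->
  facet_rate a lam k (g := g) w v <= 0.
Proof.
move=> l1 s0; rewrite /facet_rate l1 ger0_norm //.
have := mulr_ge0 s0 (facet_mass_ge0 Wf_spd k w); lra.
Qed.

(** Polarization bounds [2 w.v] by [w.w + v.v], so the interior values drop
    out. *)
Lemma facet_rate_inflow k g w v : lam k g = 1 -> dot a (enormal k g) <= 0 ->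
  facet_rate a lam k (g := g) w v <=
  `|dot a (enormal k g)| * quad (facet_mass k g) v.
Proof.
move=> l1 s0; rewrite /facet_rate l1 ler0_norm // mul1r.
set s := - _; have s_ge0 : 0 <= s by rewrite oppr_ge0.
rewrite -mulNr -/s -mulrDr ler_wpM2l //.
have := facet_mass_polarization Wf_spd k w v; lra.
Qed.

Context (conf : conformity G) (lam_ok : flux_param_ok lam).
Context (c : 'I_(nK G) -> 'cV[R]_(Np S)).
Context (ext : 'I_(nK G) -> forall g : 'I_(Nf S), 'I_(Ng g) -> R).
Context (ext_interface : forall k g i, interface_pair k g ->
  forall e : Ng (partner k g).2 = Ng g,
    ext k i = Defs.expand (c (partner k g).1)
      (xfac (cast_ord (esym e) (tau k g i)))).

Let rate (q : 'I_(nK G) * 'I_(Nf S)) : R :=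
  facet_rate a lam q.1 (g := q.2) (Vfmx q.2 *m c q.1)
    (\col_i ext q.1 (g := q.2) i).

(** The sum is [- lam |s|] times the squared norm of the jump across the
    interface. *)
Lemma interface_pair_dissipates k g : interface_pair k g ->
  rate (k, g) + rate (partner k g) <= 0.
Proof.
move=> kg; have [[lh lk plh _ nE] [e [tauE _ WE]]] := conf kg.
have lamE : lam (partner k g).1 (partner k g).2 = lam k g.
  by case: lam_ok => _ + _; apply.
have lam_ge0 : 0 <= lam k g by case: lam_ok.
have extk i := ext_interface i kg e.
have extl := @ext_interface _ _ ^~ lh.
rewrite /rate /facet_rate /= lamE nE.
move: (partner k g) => [l h] /= in e tauE WE extk extl nE plh *.
rewrite plh /= in extl.
set w := Vfmx g *m c k; set v := \col_i _; set w' := Vfmx h *m _.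
set v' := \col_i _.
have [|| -> ->] := @bform_relabel _ _ _ e (facet_mass l h) (facet_mass k g)
    _ _ w' v' w v tauE WE.
- by move=> i; rewrite mxE extk expand_xfac.
- by move=> i; rewrite mxE (extl _ (esym e)) expand_xfac esymK.
have -> : dot a (- enormal k g) = - dot a (enormal k g).
  by rewrite !dotE mulmxN mxE.
rewrite normrN (@bformC _ _ _ v).
  set z := lam k g * `| _ |.
  have z0 : 0 <= z by rewrite mulr_ge0.
  have := ler_wpM2l z0 (facet_mass_polarization Wf_spd k w v).
  lra.
by rewrite /facet_mass mul_mx_scalar linearZ /=; case: (Wf_spd g) => ->.
Qed.

(** The partner map is an involution of the interface pairs; reindexing by it
    shows that twice the sum is a sum of nonpositive pair contributions. *)
Lemma interfaces_dissipate :
  \sum_(q | ~~ `[< boundary_pair q.1 q.2 >]) rate q <= 0.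
Proof.
have inter (q : 'I_(nK G) * 'I_(Nf S)) :
    ~~ `[< boundary_pair q.1 q.2 >] -> interface_pair q.1 q.2.
  by move=> /asboolPn.
pose p (q : 'I_(nK G) * 'I_(Nf S)) := partner q.1 q.2.
have pK q : interface_pair q.1 q.2 -> p (p q) = q.
  by move=> /conf[[_ _ + _ _] _]; rewrite /p; case: q.
have p_inter q : interface_pair q.1 q.2 -> interface_pair (p q).1 (p q).2.
  by move=> /conf[[]].
have E : \sum_(q | ~~ `[< boundary_pair q.1 q.2 >]) rate q =
    \sum_(q | ~~ `[< boundary_pair q.1 q.2 >]) rate (p q).
  rewrite (reindex_onto p p) /=; last by move=> q /inter/pK.
  apply: eq_bigl => q; apply/andP/idP => [[/inter qi /eqP qE]|/inter qi].
    by apply/asboolPn; rewrite -qE; exact: p_inter.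
  by split; [apply/asboolPn; exact: p_inter|rewrite pK].
have : \sum_(q | ~~ `[< boundary_pair q.1 q.2 >]) (rate q + rate (p q)) <= 0.
  by apply: sumr_le0 => -[k g] /inter /interface_pair_dissipates.
rewrite big_split /= -E; lra.
Qed.

Lemma total_rate_le (b : forall k g, 'cV[R]_(Ng g)) :
  (forall k g, inflow_pair a k g -> \col_i ext k (g := g) i = b k g) ->
  \sum_k \sum_g rate (k, g) <=
  \sum_k \sum_(g | `[< inflow_pair a k g >])
    `|dot a (enormal k g)| * quad (facet_mass k g) (b k g).
Proof.
move=> ext_b; rewrite !pair_big_dep /=.
rewrite (bigID (fun q => `[< boundary_pair q.1 q.2 >])) /=.
rewrite -[leRHS]addr0 lerD //; last first.
  under eq_bigr => q _ do rewrite -surjective_pairing.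
  exact: interfaces_dissipate.
rewrite [leLHS](bigID (fun q => `[< inflow_pair a q.1 q.2 >])) /=.
rewrite -[leRHS]addr0 lerD //.
  rewrite [leLHS](eq_bigl (fun q => `[< inflow_pair a q.1 q.2 >])); last first.
    by move=> q; apply/andP/idP => [[]//|/asboolP[? ?]]; split; apply/asboolP.
  apply: ler_sum => -[k g] /asboolP /= kg; rewrite -ext_b //.
  case: kg => bkg s0; apply: facet_rate_inflow => //.
  by case: lam_ok => _ _; apply.
apply: sumr_le0 => -[k g] /= /andP[/asboolP bkg /asboolPn ninf].
apply: facet_rate_outflow; first by case: lam_ok => _ _; apply.
by rewrite leNgt; apply/negP => /ltW s0; apply: ninf.
Qed.

End GlobalBalance.

(** * Continuity of polynomials and derivative of a quadratic form *)

Section Continuity.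
Context {R : realType}.

Lemma continuous_sum (T : topologicalType) (I : Type) (r : seq I)
    (F : I -> T -> R) :
  (forall i, continuous (F i)) -> continuous (fun x => \sum_(i <- r) F i x).
Proof. by move=> Fc; apply: continuous_big => //; exact: add_continuous. Qed.

Lemma continuous_prod (T : topologicalType) (I : Type) (r : seq I)
    (F : I -> T -> R) :
  (forall i, continuous (F i)) -> continuous (fun x => \prod_(i <- r) F i x).
Proof. by move=> Fc; apply: continuous_big => //; exact: mul_continuous. Qed.

Lemma mulmx_continuous m n p (A : 'M[R]_(m, n)) :
  continuous (fun x : 'M[R]_(n, p) => A *m x).
Proof.
have FF (x : 'M[R]_(n, p)) : Filter (nbhs x) by exact: nbhs_filter.
move=> x B [P Px PB].
(* A neighbourhood of a matrix contains a product of neighbourhoods of its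
   entries. *)
have : \forall y \near x, forall ij, P ij.1 ij.2 ((A *m y) ij.1 ij.2).
  refine (@filter_forall _ _ (fun (ij : 'I_m * 'I_p) (y : 'M[R]_(n, p)) =>
    P ij.1 ij.2 ((A *m y) ij.1 ij.2)) _ (FF x) _) => -[i j] /=.
  have : continuous (fun y : 'M[R]_(n, p) => \sum_k A i k * y k j).
    apply: continuous_sum => k y.
    apply: continuousM; first exact: cst_continuous.
    exact: coord_continuous.
  move=> /(_ x (P i j)); have := Px i j; rewrite mxE => Pij /(_ Pij).
  by apply: (@filterS _ _ (FF x)) => y; rewrite /= mxE.
by apply: (@filterS _ _ (FF x)) => y Py; apply: PB => i j; exact: (Py (i, j)).
Qed.

Lemma polyV_continuous d (S : ref_scheme R d) f : polyV S f -> continuous f.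
Proof.
move=> [c ->]; apply: continuous_sum => al x.
apply: continuousM; first exact: cst_continuous.
suff : continuous (@monomial R d al) by exact.
apply: continuous_prod => k {}x.
apply: (@continuous_comp _ _ _ (fun y : 'cV[R]_d => y k 0)
  (fun r : R => r ^+ al k)); last exact: exprn_continuous.
exact: coord_continuous.
Qed.

Lemma expand_continuous p d (S : ref_scheme R d) (S_ok : ref_scheme_ok S p)
    (c : 'cV[R]_(Np S)) :
  continuous (Defs.expand c : 'cV[R]_d -> R).
Proof.
apply: continuous_sum => i x; apply: continuousM; first exact: cst_continuous.
exact: (polyV_continuous (phi_in S_ok i)).
Qed.

(** By continuity the two polynomials agree on the whole reference element,
    hence at the nodes, and [V] is injective. *)
Lemma expand_eq_on_interior p d (S : ref_scheme R d) (S_ok : ref_scheme_ok S p)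
    (V_rank : \rank (Vmx S) = Np S) (c c' : 'cV[R]_(Np S)) :
  (forall x, (dom S)° x -> Defs.expand c x = Defs.expand c' x) -> c = c'.
Proof.
move=> cc'.
have node i : Defs.expand (c - c') (@xvol R d S i) = 0.
  have : closure [set x | Defs.expand (c - c') x = 0] (@xvol R d S i).
    have := xvol_in S_ok i; rewrite -{1}(polytope_regular (dom_polytope S_ok)).
    apply: closureS => x /cc' xE.
    rewrite /Defs.expand /=; under eq_bigr => j _ do rewrite !mxE mulrBl.
    by rewrite sumrB; apply/eqP; rewrite subr_eq0; apply/eqP.
  apply: (@preimage_closed _ _ (Defs.expand (c - c')) [set x | x = 0]).
    by move=> ? _; exact: expand_continuous S_ok _ _.
  exact: closed_eq.
apply/eqP; rewrite -subr_eq0 -trmx_eq0.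
have /mulmx_free_eq0 <- : row_free (Vmx S)^T.
  by rewrite /row_free mxrank_tr V_rank.
rewrite -trmx_mul trmx_eq0; apply/eqP/matrixP => i j.
by rewrite ord1 -expand_xvol node mxE.
Qed.

Lemma affine_interior d (D : set 'cV[R]_d) (f : 'cV[R]_d -> 'cV[R]_d) J b x :
  J \in unitmx -> (forall y, f y = J *m y + b) ->
  D° x -> (f @` D)° (f x).
Proof.
move=> Ju fE Dx.
have inv_cont : continuous (fun y : 'cV[R]_d => invmx J *m (y - b)).
  move=> y; apply: (@continuous_comp 'cV[R]_d 'cV[R]_d 'cV[R]_d (fun y => y - b)
    (fun z => invmx J *m z)); last exact: mulmx_continuous.
  by apply: continuousB; [move=> ?|exact: cst_continuous].
have : open ((fun y => invmx J *m (y - b)) @^-1` D°).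
  by apply: open_comp; [move=> y _; exact: inv_cont|exact: open_interior].
rewrite openE => /(_ (f x)) /=; rewrite fE addrK mulKmx // => /(_ Dx).
apply: filterS => y /= Dy; exists (invmx J *m (y - b)).
  exact: interior_subset.
by rewrite fE mulKVmx // subrK.
Qed.

Lemma is_derive_quad n (A : 'M[R]_n) (x : R -> 'cV[R]_n) t :
  A^T = A -> derivable x t 1 ->
  is_derive t 1 (fun s => quad A (x s)) (2 * bform A (x t) (x^`()%classic t)).
Proof.
move=> As xd.
have xi i : is_derive t 1 (fun s => x s i 0) ((x^`()%classic t) i 0).
  rewrite derive1E derive_mx // mxE; apply: derivableP.
  by move/derivable_mxP : xd.
have bE y z : bform A y z = \sum_(i < n) \sum_(j < n) A i j * (y i 0 * z j 0).
  rewrite /bform mxE exchange_big /=; apply: eq_bigr => j _.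
  rewrite mxE mulr_suml; apply: eq_bigr => i _.
  by rewrite mxE; ring.
have -> : (fun s => quad A (x s)) =
    \sum_(i < n) \sum_(j < n) A i j \*: ((fun s => x s i 0) *
                                         (fun s => x s j 0)).
  apply/funext => s; rewrite quadE bE fct_sumE; apply: eq_bigr => i _.
  by rewrite fct_sumE.
set x' := (x^`()%classic t).
apply: (@is_derive_eq _ _ _ _ _ _ _ (\sum_(i < n) \sum_(j < n)
    A i j *: (x t i 0 *: x' j 0 + x t j 0 *: x' i 0))).
  apply: is_derive_sum => i; apply: is_derive_sum => j.
  by apply: is_deriveZ; apply: is_deriveM; exact: xi.
rewrite mulr_natl mulr2n [in X in _ = X + _]bformC // !bE.
rewrite -big_split; apply: eq_bigr => i _; rewrite -big_split.
apply: eq_bigr => j _ /=; rewrite /GRing.scale /=; ring.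
Qed.

End Continuity.

(** [broken_poly] only sees the interiors of the elements; an affine isomorphism
    maps the interior of the reference element into them. *)
Lemma broken_poly_inj (R : realType) (d p : nat) (S : ref_scheme R d)
    (G : mesh S) (S_ok : ref_scheme_ok S p) (G_ok : mesh_ok G)
    (V_rank : \rank (Vmx S) = Np S) (aff : affine_mappings G)
    v (c c' : 'I_(nK G) -> 'cV[R]_(Np S)) :
  broken_poly v c -> broken_poly v c' -> c = c'.
Proof.
move=> vc vc'; apply/funext => k.
apply: (expand_eq_on_interior S_ok) => // x Dx.
have Dx' : dom S x := interior_subset Dx.
have [b fE] := aff k.
have Ju : Jac k \in unitmx by rewrite unitmxE unitfE gt_eqF // Jdet_gt0.
have kx : (elem k)° (X k x) by exact: affine_interior Ju fE Dx.
by rewrite -vc // -vc'.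
Qed.

(** * Energy stability *)

Theorem theorem4p5 (R : realType) (d p : nat) (S : ref_scheme R d) (G : mesh S)
    (a : 'cV[R]_d) (B : 'cV[R]_d -> R -> R)
    (lam : 'I_(nK G) -> 'I_(Nf S) -> R) (T : R)
    (u : 'I_(nK G) -> R -> 'cV[R]_(Np S))
    (Uext : 'I_(nK G) -> forall g : 'I_(Nf S), 'I_(Ng g) -> R -> R)
    (Uh : R -> 'cV[R]_d -> R)
    (d_gt0 : (0 < d)%N)
    (S_ok : ref_scheme_ok S p)
    (G_ok : mesh_ok G)
    (sbp : SBP_property S)
    (V_rank : \rank (Vmx S) = Np S)
    (W_spd : spd (W S))
    (Wf_spd : forall g : 'I_(Nf S), spd (Wf g))
    (KD_eq0 : forall m : 'I_d, Kmx S *m Dm S m = 0)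
    (MK_spd : spd (Mmx S + Kmx S))
    (conf : conformity G)
    (aff : affine_mappings G)
    (lam_ok : flux_param_ok lam)
    (Uext_ok : external_state a B T u Uext)
    (u_diff : forall k (t : R), 0 < t < T -> derivable (u k) t 1)
    (u_method : FR_method a lam T u Uext \/
                (Kmx S = 0 /\ DG_method a lam T u Uext))
    (Uh_def : forall t : R, 0 < t < T -> broken_poly (Uh t) (fun k => u k t)) :
  forall t : R, 0 < t < T ->
    [/\ derivable (fun s : R => energy (fun k => u k s)) t 1,
        (fun s : R => energy (fun k => u k s))^`()%classic t <=
          \sum_(k < nK G) \sum_(g < Nf S | `[< inflow_pair a k g >])
            `|dot a (enormal k g)| *
            quad (Wf g *m (Jfac k g)%:M) (bdata B k g t) &
        Vh_norm G (Uh t) ^+ 2 = energy (fun k => u k t)].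
Proof.
have M_spd := Mmx_spd W_spd V_rank.
have Mu := spd_unitmx M_spd.
have J0 := Jdet_gt0 G_ok.
move=> t tT.
have dE : is_derive t (1 : R) (fun s : R => energy (fun k => u k s))
    (\sum_k Jdet k * (2 * bform (Mmx S + Kmx S) (u k t) ((u k)^`()%classic t))).
  have -> : (fun s : R => energy (fun k => u k s)) =
      \sum_k Jdet k \*: (fun s => quad (Mmx S + Kmx S) (u k s)).
    by apply/funext => s; rewrite fct_sumE energyE.
  apply: is_derive_sum => k; apply: is_deriveZ.
  by apply: is_derive_quad; [case: MK_spd|exact: u_diff].
split.
- by case: dE.
- rewrite derive1E derive_val.
  pose ext k (g : 'I_(Nf S)) (i : 'I_(Ng g)) : R := Uext k g i t.
  rewrite (eq_bigr (fun k => \sum_g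
      facet_rate a lam k (Vfmx g *m u k t) (\col_i ext k g i))); last first.
    move=> k _; rewrite mulrCA; case: u_method => [FR|[K0 DG]].
      exact: (FR_rate S_ok sbp M_spd MK_spd KD_eq0 (FR k t tT)).
    exact: (DG_rate S_ok sbp M_spd K0 (DG k t tT)).
  apply: (@total_rate_le _ _ _ G a lam Wf_spd conf lam_ok (fun k => u k t) ext
     _ (fun k g => bdata B k g t)).
    by move=> k g i kg e; have [+ _] := Uext_ok k g i t tT; exact.
  move=> k g kg; apply/matrixP => i j; rewrite !mxE.
  by have [_ /(_ kg)] := Uext_ok k g i t tT.
- have -> : Vh_norm G (Uh t) = Num.sqrt (energy (fun k => u k t)).
    congr (Num.sqrt (energy _)); apply: xget_unique; first exact: Uh_def.
    by move=> c /= /broken_poly_inj; apply => //; [exact: S_ok|exact: Uh_def].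
  apply: sqr_sqrtr; rewrite energyE //; apply: sumr_ge0 => k _.
  by rewrite mulr_ge0 ?(ltW (J0 k)) ?spd_quad_ge0.
Qed.
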